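(* Let $d\in\mathbb{N}^*$ and $\mathbf{T}=(T_1,\dots,T_d)\in\mathcal{B}(\mathcal{H})^d$, with $\dim\mathcal{H}=2$. If there exists $i\in\{1,\dots,d\}$ such that $T_i$ is not a scalar operator and $T_iT_j=T_jT_i$ for all $j\in\{1,\dots,d\}$ with $j\ne i$, then $JtW_q(\mathbf{T})$ is convex.
   Context: $\mathbb{N}^*$ is the set of positive integers. $\mathcal{H}$ is a complex Hilbert space, $\mathcal{B}(\mathcal{H})$ is the algebra of bounded linear operators on $\mathcal{H}$, and $q\in\mathbb{C}$ is fixed with $|q|\le 1$. A scalar operator is a complex multiple of the identity. Put $\mathbb{S}_q(\mathcal{H})=\{(x,y)\in\mathcal{H}\times\mathcal{H}: \|x\|=\|y\|=1,\ \langle x,y\rangle=q\}$. The joint $q$-numerical range of $\mathbf{T}$ is $JtW_q(\mathbf{T})=\{(\langle T_1x,y\rangle,\dots,\langle T_dx,y\rangle)\in\mathbb{C}^d : (x,y)\in\mathbb{S}_q(\mathcal{H})\}$. *)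

(* Defs.v *)
From mathcomp Require Export all_boot all_order all_algebra.
From mathcomp Require Export sesquilinear.
From mathcomp Require Export classical_sets reals convex.
From mathcomp Require Export complex.

Set Implicit Arguments.
Unset Strict Implicit.
Unset Printing Implicit Defensive.

Import Order.TTheory GRing.Theory Num.Theory.
Local Open Scope ring_scope.
Local Open Scope classical_set_scope.
Local Open Scope complex_scope.

(* A finite-dimensional complex Hilbert space is a vectType over R[i] together
   with a positive definite Hermitian form, linear in its first argument and
   conjugate-linear in its second.  In finite dimension such a space is complete
   and every endomorphism is bounded, so 'End(H) is all of B(H). *)

Definition dot_norm (R : realType) (H : vectType R[i])
    (dot : {dot H for Num.conj}) (x : H) : R[i] := sqrtC (dot x x).

Definition qsphere (R : realType) (H : vectType R[i])
    (dot : {dot H for Num.conj}) (q : R[i]) : set (H * H) :=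
  [set p | [/\ dot_norm dot p.1 = 1, dot_norm dot p.2 = 1 & dot p.1 p.2 = q]].

Definition joint_qrange (R : realType) (H : vectType R[i])
    (dot : {dot H for Num.conj}) (q : R[i]) (d : nat)
    (T : 'I_d -> 'End(H)) : set 'rV[R[i]]_d :=
  [set \row_j dot (T j p.1) p.2 | p in qsphere dot q].

Definition scalar_operator (R : realType) (H : vectType R[i])
    (A : 'End(H)) : Prop :=
  exists c : R[i], A = c *: \1%VF.

(* Main.v *)
Require Import Defs.
From mathcomp Require Import interval_inference boolp ring lra.

(** Since [T i] is not scalar and [H] has dimension 2, its commutant consists of
    the operators [a + b * T i] ([commutant_nonscalar]).  For a pair with
    [dot x y = q] this gives [dot (T j x) y = a * q + b * dot (T i x) y], so the
    joint range is the image of the [q]-numerical range of the single operator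
    [A = T i] under a complex affine map, and it is enough that this range be
    an elliptic disc (Tsing's convexity theorem, in dimension 2).

    An orthonormal basis can be chosen in which the two diagonal entries of [A]
    are equal ([equal_diagonal_basis]).  The diagonal then only contributes a
    translation, and the range becomes the set of all
    [b * (x2 * y1^* ) + c * (x1 * y2^* )] for unit vectors [x], [y] of C^2 with
    [dot x y = q].  Phases are absorbed so that [b, c, q] become nonnegative.
    With [2 * g * h = q] and [g^2 + h^2 = 1], these pairs are, up to a common
    phase that does not affect the products used,
      [x = ((g v - h w)^*, h v + g w)], [y = ((h v - g w)^*, g v + h w)]
    with [|v|^2 + |w|^2 = 1] ([qpair_param], [param_qpair]).  Putting
    [p = v^2] and [r = - w^2], the range is the set of sums [D1 p + D2 r] with
    [|p| + |r| = 1], where [D1] and [D2] are real diagonal maps of the plane.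
    One of them dominates the other entrywise, say [D2], so that
    [D1 = D2 K] with [K] a contraction.  The sums are then [D2 (K p + r)], and
    [K p + r] runs over exactly the closed unit disc: it stays inside by the
    triangle inequality, and for a given [rho] in the disc the function
    [|p| + |rho - K p|] of [p = t >= 0] goes from [|rho| <= 1] at [t = 0] to
    at least 1 at [t = 1], hence takes the value 1 ([split_unit_disc]).  So the
    range is the elliptic disc [D2 (unit disc)]. *)

Set Implicit Arguments.
Unset Strict Implicit.
Unset Printing Implicit Defensive.

Import Order.TTheory GRing.Theory Num.Theory.
Local Open Scope ring_scope.
Local Open Scope classical_set_scope.

(** * Pairs of unit vectors of C^2 with a prescribed inner product *)

Section QPairs.
Variable C : numClosedFieldType.
Implicit Types x y v w z : C.

Lemma unit_phase z : exists2 u : C, `|u| = 1 & z = `|z| * u.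
Proof.
have [->|z0] := eqVneq z 0; first by exists 1; rewrite ?normr1 // normr0 mul0r.
have nz0 : `|z| != 0 by rewrite normr_eq0.
exists (z / `|z|); first by rewrite normrM normfV normr_id divff.
by rewrite mulrC divfK.
Qed.

Lemma unit_mul_conj u : `|u| = 1 -> u * u^* = 1 :> C.
Proof. by move=> u1; rewrite -normCK u1 expr1n. Qed.

Lemma unit_sqrt u : `|u| = 1 -> exists2 e : C, `|e| = 1 & e ^+ 2 = u.
Proof.
move=> u1; exists (sqrtC u); last exact: sqrtCK.
by apply/eqP; rewrite -(@pexpr_eq1 _ _ 2) // -normrX sqrtCK u1.
Qed.

Definition qpair q x1 x2 y1 y2 : Prop :=
  [/\ x1 * x1^* + x2 * x2^* = 1, y1 * y1^* + y2 * y2^* = 1 &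
      x1 * y1^* + x2 * y2^* = q].

(** Relative to [x], the vector [y] is [q x + s om^* z] with [s = g^2 - h^2]
    (so [s^2 = 1 - q^2]), [z = (- x2^*, x1^* )] a unit vector orthogonal to
    [x], and [om] a phase.  Multiplying both vectors by a square root [e] of
    [om] leaves the products [x2 * y1^*] and [x1 * y2^*] unchanged and removes
    the phase.  Then [(v, w)] is the image of [(x1^*, x2)] under the rotation
    of cosine [g] and sine [h], in which the two products factor as
    differences of squares. *)
Lemma qpair_param g h x1 x2 y1 y2 :
  g^* = g -> h^* = h -> g ^+ 2 + h ^+ 2 = 1 ->
  qpair (2 * g * h) x1 x2 y1 y2 ->
  exists v w, [/\ v * v^* + w * w^* = 1,
    x2 * y1^* = h ^+ 2 * v ^+ 2 - g ^+ 2 * w ^+ 2 &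
    x1 * y2^* = (g ^+ 2 * v ^+ 2 - h ^+ 2 * w ^+ 2)^*].
Proof.
move=> gJ hJ gh; move qE : (2 * g * h) => q [x1N y1N xyq].
have qJ : q^* = q by rewrite -qE !rmorphM /= gJ hJ conjC_nat.
move sE : (g ^+ 2 - h ^+ 2) => s.
have sJ : s^* = s by rewrite -sE rmorphB !rmorphXn /= gJ hJ.
have qs : q ^+ 2 + s ^+ 2 = 1.
  by rewrite -[1](expr1n _ 2) -gh -qE -sE; ring.
(* [sg] is the conjugate of the coordinate of [y - q x] along [z]. *)
move sgE : ((y2^* - q * x2^*) * x1^* - (y1^* - q * x1^*) * x2^*) => sg.
have y1E : y1^* = q * x1^* - sg * x2.
  transitivity (y1^* * (x1 * x1^* + x2 * x2^*) +
                x1^* * (q - (x1 * y1^* + x2 * y2^*))).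
    by rewrite x1N xyq subrr mulr0 addr0 mulr1.
  by rewrite -sgE; ring.
have y2E : y2^* = q * x2^* + sg * x1.
  transitivity (y2^* * (x1 * x1^* + x2 * x2^*) +
                x2^* * (q - (x1 * y1^* + x2 * y2^*))).
    by rewrite x1N xyq subrr mulr0 addr0 mulr1.
  by rewrite -sgE; ring.
have y1E' : y1 = q * x1 - sg^* * x2^*.
  by rewrite -[y1]conjCK y1E rmorphB 2!rmorphM /= conjCK qJ.
have y2E' : y2 = q * x2 + sg^* * x1^*.
  by rewrite -[y2]conjCK y2E rmorphD 2!rmorphM /= conjCK qJ.
(* Pythagoras: [1 = |y|^2 = q^2 + |sg|^2]. *)
have sgN : `|sg| ^+ 2 = s ^+ 2.
  rewrite normCK -[s ^+ 2](addKr (q ^+ 2)) qs -y1N y1E y2E y1E' y2E'.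
  transitivity ((x1 * x1^* + x2 * x2^*) * (q ^+ 2 + sg * sg^*) - q ^+ 2).
    by rewrite x1N; ring.
  by ring.
have [om om1 sgom] : exists2 om : C, `|om| = 1 & sg = s * om.
  have [s0|s0] := eqVneq s 0.
    exists 1; rewrite ?normr1 // s0 mul0r; apply/eqP.
    by rewrite -normr_eq0 -sqrf_eq0 sgN s0 expr0n.
  exists (sg / s); last by rewrite mulrC divfK.
  apply/eqP; rewrite -(@pexpr_eq1 _ _ 2) // normrM normfV exprMn exprVn sgN.
  by rewrite normCK sJ -expr2 divff // expf_neq0.
have [e e1 eE] := unit_sqrt om1; have eJ := unit_mul_conj e1.
(* The rotated coordinates of the pair multiplied by [e]. *)
exists (g * e^* * x1^* + h * e * x2), (g * e * x2 - h * e^* * x1^*).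
split.
- rewrite rmorphB rmorphD !rmorphM /= !conjCK gJ hJ.
  transitivity ((g ^+ 2 + h ^+ 2) * (e * e^*) * (x1 * x1^* + x2 * x2^*));
    first by ring.
  by rewrite gh eJ x1N !mulr1.
- transitivity ((q * (e * e^*) * x1^* - s * e ^+ 2 * x2) * x2 * (g ^+ 2 + h ^+ 2)).
    by rewrite gh eJ y1E sgom eE; ring.
  by rewrite -qE -sE; ring.
- transitivity ((q * (e * e^*) * x2^* + s * e ^+ 2 * x1) * x1 * (g ^+ 2 + h ^+ 2)).
    by rewrite gh eJ y2E sgom eE; ring.
  rewrite !(rmorphB, rmorphD, rmorphM, conjCK) /= !gJ !hJ !conjCK -qE -sE.
  by ring.
Qed.

Lemma param_qpair g h v w :
  g^* = g -> h^* = h -> g ^+ 2 + h ^+ 2 = 1 -> v * v^* + w * w^* = 1 ->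
  qpair (2 * g * h) (g * v - h * w)^* (h * v + g * w)
                    (h * v - g * w)^* (g * v + h * w).
Proof.
move=> gJ hJ gh vw; rewrite /qpair !(conjCK, rmorphB, rmorphD, rmorphM) /= !gJ !hJ.
split.
- by rewrite -[1]mulr1 -{1}gh -vw; ring.
- by rewrite -[1]mulr1 -{1}gh -vw; ring.
- by transitivity (2 * g * h * (v * v^* + w * w^*)); [ring|rewrite vw mulr1].
Qed.

(** The [q]-numerical range of the matrix with zero diagonal and off-diagonal
    entries [b] (upper right) and [c] (lower left). *)
Definition antidiag_range b c q : set C :=
  [set z | exists x1 x2 y1 y2,
    qpair q x1 x2 y1 y2 /\ z = b * (x2 * y1^*) + c * (x1 * y2^*)].

(** The value of [b * (x2 * y1^* ) + c * (x1 * y2^* )] in the variables [p = v^2]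
    and [r = - w^2] of [qpair_param]. *)
Definition two_phase_sum g h b c p r : C :=
  b * (h ^+ 2 * p + g ^+ 2 * r) + c * (g ^+ 2 * p + h ^+ 2 * r)^*.

(** Every complex number is a square, so [p = v^2] and [r = - w^2] are subject
    only to [|p| + |r| = |v|^2 + |w|^2 = 1]. *)
Lemma antidiag_range_param g h b c :
  g^* = g -> h^* = h -> g ^+ 2 + h ^+ 2 = 1 ->
  antidiag_range b c (2 * g * h) =
  [set z | exists p r, `|p| + `|r| = 1 /\ z = two_phase_sum g h b c p r].
Proof.
move=> gJ hJ gh; rewrite eqEsubset; split=> z.
  move=> [x1 [x2 [y1 [y2 [xy ->]]]]].
  have [v [w [vw -> ->]]] := qpair_param gJ hJ gh xy.
  exists (v ^+ 2), (- w ^+ 2); split; first by rewrite normrN !normrX !normCK.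
  by rewrite /two_phase_sum !mulrN.
move=> [p [r [pr ->]]].
pose v := sqrtC p; pose w := sqrtC (- r).
have vw : v * v^* + w * w^* = 1 by rewrite -!normCK -!normrX !sqrtCK normrN.
have := param_qpair gJ hJ gh vw.
set x1 := (_ - _)^*; set x2 := _ + _; set y1 := (_ - _)^*; set y2 := _ + _ => xy.
exists x1, x2, y1, y2; split => //; rewrite /two_phase_sum; congr (_ * _ + _ * _).
  rewrite /x2 /y1 conjCK -[p]sqrtCK -[r]opprK -[- r]sqrtCK -/v -/w; ring.
rewrite /x1 /y2 -rmorphM; congr (_^*).
rewrite -[p]sqrtCK -[r]opprK -[- r]sqrtCK -/v -/w; ring.
Qed.

(** Multiplying [y] by [k^* = k^-1] multiplies both [q] and the range by [k]. *)
Lemma antidiag_range_rot b c q k : `|k| = 1 ->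
  antidiag_range b c (k * q) = [set k * z | z in antidiag_range b c q].
Proof.
move=> k1; have kJ := unit_mul_conj k1.
rewrite eqEsubset; split=> [_ [x1 [x2 [y1 [y2 [[xN yN xy] ->]]]]]|].
  exists (b * (x2 * (k * y1)^*) + c * (x1 * (k * y2)^*)); last first.
    transitivity (k * k^* * (b * (x2 * y1^*) + c * (x1 * y2^*))).
      by rewrite !rmorphM; ring.
    by rewrite kJ mul1r.
  exists x1, x2, (k * y1), (k * y2); split => //; split => //.
    transitivity (k * k^* * (y1 * y1^* + y2 * y2^*)).
      by rewrite !rmorphM; ring.
    by rewrite kJ yN mul1r.
  transitivity (k^* * (x1 * y1^* + x2 * y2^*)); first by rewrite !rmorphM; ring.
  by rewrite xy mulrA [_^* * k]mulrC kJ mul1r.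
move=> _ [_ [x1 [x2 [y1 [y2 [[xN yN xy] ->]]]]] <-].
exists x1, x2, (k^* * y1), (k^* * y2); split; last first.
  by rewrite !rmorphM /= !conjCK; ring.
split => //.
  transitivity (k * k^* * (y1 * y1^* + y2 * y2^*)).
    by rewrite !rmorphM /= !conjCK; ring.
  by rewrite kJ yN mul1r.
by rewrite -xy !rmorphM /= !conjCK; ring.
Qed.

(** The phases of [b] and [c] are [l m] and [l m^*] for [l] a square root of
    their product: one phase common to both and one that [c] conjugates. *)
Lemma common_phases b c :
  exists l m : C, [/\ `|l| = 1, `|m| = 1, b = `|b| * (l * m) & c = `|c| * (l * m^*)].
Proof.
have [be be1 bE] := unit_phase b; have [ga ga1 cE] := unit_phase c.
have [l l1 lE] : exists2 l : C, `|l| = 1 & l ^+ 2 = be * ga.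
  by apply: unit_sqrt; rewrite normrM be1 ga1 mulr1.
have lJ := unit_mul_conj l1; have beJ := unit_mul_conj be1.
exists l, (be * l^*); split => //; first by rewrite normrM norm_conjC be1 l1 mulr1.
  by rewrite [l * _]mulrCA lJ mulr1.
rewrite rmorphM /= conjCK.
suff -> : l * (be^* * l) = ga by [].
transitivity (be^* * l ^+ 2); first by ring.
by rewrite lE mulrA [_^* * _]mulrC beJ mul1r.
Qed.

(** The common phase [l] of [common_phases] rotates the range; the other phase
    [m] is absorbed in [p] and [r], since [c] multiplies a conjugate. *)
Lemma antidiag_range_phase g h b c :
  g^* = g -> h^* = h -> g ^+ 2 + h ^+ 2 = 1 ->
  exists l, antidiag_range b c (2 * g * h) =
  [set z | exists p r, `|p| + `|r| = 1 /\
                       z = l * two_phase_sum g h `|b| `|c| p r].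
Proof.
move=> gJ hJ gh; have [l [m [l1 m1 bE cE]]] := common_phases b c.
have mJ := unit_mul_conj m1.
exists l; rewrite antidiag_range_param // eqEsubset.
split=> _ [p [r [pr ->]]].
  exists (m * p), (m * r); split; first by rewrite !normrM m1 !mul1r.
  rewrite /two_phase_sum {1}bE {1}cE !(rmorphD, rmorphM) /= gJ hJ; ring.
exists (m^* * p), (m^* * r); split.
  by rewrite !normrM norm_conjC m1 !mul1r.
rewrite /two_phase_sum {2}bE {2}cE.
transitivity (m * m^* * (l * two_phase_sum g h `|b| `|c| p r)).
  by rewrite mJ mul1r.
rewrite /two_phase_sum !(rmorphD, rmorphM) /= !conjCK; ring.
Qed.

End QPairs.

(** * Isotropic vectors of traceless matrices *)

Section Isotropic.
Variable C : numClosedFieldType.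
Implicit Types a b c k t : C.

Lemma real_quadratic_root k : k \is Num.real ->
  exists2 t : C, t \is Num.real & 1 + k * t - t ^+ 2 = 0.
Proof.
move=> kR; pose d := sqrtC (k ^+ 2 + 4).
have dE : d ^+ 2 = k ^+ 2 + 4 by rewrite sqrtCK.
have k2 : 0 <= k ^+ 2 by rewrite real_exprn_even_ge0.
have dR : d \is Num.real by rewrite ger0_real // sqrtC_ge0 addr_ge0.
exists ((k + d) / 2); first by rewrite realM ?realD // realV realn.
by transitivity (1 + (k ^+ 2 - d ^+ 2) / 4); [field|rewrite dE; field].
Qed.

(** For [a != 0], look for [x] proportional to [(1, t om)] with [t] real and
    [om] a phase.  The equation becomes
    [a (1 - t^2) + t (b om + c om^* ) = 0], and once [om] makes
    [k = (b om + c om^* ) / a] real it is the quadratic [1 + k t - t^2 = 0],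
    whose discriminant [k^2 + 4] is positive. *)
Lemma traceless_isotropic a b c : exists x1 x2,
  x1 * x1^* + x2 * x2^* = 1 /\
  a * (x1 * x1^* - x2 * x2^*) + b * (x2 * x1^*) + c * (x1 * x2^*) = 0.
Proof.
have [->|a0] := eqVneq a 0.
  by exists 1, 0; rewrite conjC1 conjC0; split; ring.
(* [k] is real as soon as [(a^* b - a c^* ) om] is, hence the conjugate phase. *)
have [u u1 uE] := unit_phase (a^* * b - a * c^*); set n := `|_| in uE.
have uJ := unit_mul_conj u1.
have nJ : n^* = n by apply: CrealP; rewrite normr_real.
move omE : (u^*) => om.
have omJ : om * om^* = 1 by rewrite -omE conjCK mulrC.
pose k := (b * om + c * om^*) / a.
have kR : k \is Num.real.
  apply/CrealP; rewrite /k rmorphM rmorphD !rmorphM fmorphV /= conjCK.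
  have aJ0 : a^* != 0 by rewrite conjC_eq0.
  apply: (mulfI (mulf_neq0 a0 aJ0)).
  transitivity (a * (b^* * om^* + c^* * om)); first by field.
  transitivity (a^* * (b * om + c * om^*)); last by field.
  apply/eqP; rewrite -subr_eq0; apply/eqP.
  have nE : n = (a^* * b - a * c^*) * om by rewrite uE -omE -mulrA uJ mulr1.
  transitivity (n^* - n); last by rewrite nJ subrr.
  by rewrite nE !(rmorphB, rmorphM) /= !conjCK; ring.
have [t tR tE] := real_quadratic_root kR.
have tJ : t^* = t by apply: CrealP.
have t2 : 0 < 1 + t ^+ 2 by rewrite ltr_pwDl // real_exprn_even_ge0.
pose N := sqrtC (1 + t ^+ 2).
have NE : N ^+ 2 = 1 + t ^+ 2 by rewrite sqrtCK.
have NJ : N^* = N by apply: CrealP; rewrite ger0_real // sqrtC_ge0 ltW.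
have N0 : N != 0 by rewrite sqrtC_eq0 gt_eqF.
exists N^-1, (t * om / N).
have NVJ : (N^-1)^* = N^-1 by rewrite fmorphV /= NJ.
rewrite !rmorphM /= NVJ tJ; split.
  transitivity ((1 + t ^+ 2 * (om * om^*)) / N ^+ 2); first by field.
  by rewrite omJ mulr1 NE divff // -NE expf_neq0.
transitivity ((a * (1 - t ^+ 2 * (om * om^*)) + t * (b * om + c * om^*)) / N ^+ 2).
  by field.
have -> : b * om + c * om^* = k * a by rewrite divfK.
transitivity (a * (1 + k * t - t ^+ 2) / N ^+ 2); last by rewrite tE mulr0 mul0r.
by rewrite omJ; field.
Qed.
End Isotropic.

(** * Sums of two ellipses *)

Local Open Scope complex_scope.

Section Ellipses.
Variable R : rcfType.
Implicit Types (m n : R) (p r w z rho : R[i]).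

Definition stretch m n z : R[i] := (m * complex.Re z) +i* (n * complex.Im z).

Lemma stretchD m n p r : stretch m n (p + r) = stretch m n p + stretch m n r.
Proof. by case: p r => [p1 p2] [r1 r2]; rewrite /stretch /=; simpc; rewrite !mulrDr. Qed.

Lemma stretchM m n m' n' p :
  stretch m n (stretch m' n' p) = stretch (m * m') (n * n') p.
Proof. by rewrite /stretch /= !mulrA. Qed.

Lemma norm_stretch_le m n p : `|m| <= 1 -> `|n| <= 1 -> `|stretch m n p| <= `|p|.
Proof.
case: p => p1 p2 m1 n1; rewrite !normc_def lecR /= ler_wsqrtr //.
have sq_le1 (a : R) : `|a| <= 1 -> a ^+ 2 <= 1.
  by move=> a1; rewrite -real_normK ?num_real // expr_le1.
by rewrite lerD // exprMn ler_piMl ?sqr_ge0 ?sq_le1.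
Qed.

Lemma norm_div_le1 (a b : R) : `|a| <= `|b| -> `|a / b| <= 1.
Proof.
have [->|b0] := eqVneq b 0; first by rewrite invr0 mulr0 normr0.
by move=> ab; rewrite normrM normfV ler_pdivrMr ?normr_gt0 // mul1r.
Qed.

(** Domination makes the quotient meaningful even for [b = 0], as then [a = 0]. *)
Lemma divfK_le (a b : R) : `|a| <= `|b| -> b * (a / b) = a.
Proof.
have [->|b0] := eqVneq b 0; last by move=> _; rewrite mulrC divfK.
by rewrite normr0 normr_le0 mul0r => /eqP.
Qed.

(** A root in [0, 1] of the quadratic [|rho - k t|^2 - (1 - t)^2], which is
    nonpositive at 0 because [|rho| <= 1] and nonnegative at 1. *)
Lemma split_unit_disc (k : R) rho : `|rho| <= 1 ->
  exists t : R, [/\ 0 <= t, t <= 1 & `|rho - (k * t)%:C| = (1 - t)%:C].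
Proof.
case: rho => a b; rewrite normc_def /= -[1]/(1%:C) lecR => rho1.
have {}rho1 : a ^+ 2 + b ^+ 2 <= 1.
  by rewrite -[_ + _]sqr_sqrtr ?addr_ge0 ?sqr_ge0 // expr_le1 // sqrtr_ge0.
pose P : {poly R} := (a%:P - k *: 'X) ^+ 2 + (b ^+ 2)%:P - (1 - 'X) ^+ 2.
have PE t : P.[t] = (a - k * t) ^+ 2 + b ^+ 2 - (1 - t) ^+ 2.
  by rewrite /P !hornerE.
have [||t /andP[t0 t1] /rootP] := @poly_ivt R P 0 1; first exact: ler01.
  rewrite !PE mulr0 !subr0 expr1n subr_le0 rho1 /= subrr expr0n subr0.
  by rewrite addr_ge0 ?sqr_ge0.
rewrite PE => /eqP; rewrite subr_eq0 => /eqP Pt.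
exists t; split => //.
rewrite normc_def /=; congr (_%:C).
by rewrite subr0 Pt sqrtr_sqr ger0_norm // subr_ge0.
Qed.

(** Let [K] be the contraction of entries [m1 / m2], [n1 / n2].  The sums are
    the [stretch m2 n2 (K p + r)], and [K p + r] runs over the unit disc.  To
    reach [rho] a real [p >= 0] is enough, on which [K] acts as [m1 / m2]. *)
Lemma stretch_sum_disc m1 n1 m2 n2 z : `|m1| <= `|m2| -> `|n1| <= `|n2| ->
  (exists p r, `|p| + `|r| = 1 /\ z = stretch m1 n1 p + stretch m2 n2 r) <->
  (exists rho, `|rho| <= 1 /\ z = stretch m2 n2 rho).
Proof.
move=> lem len; split=> [[p [r [pr ->]]]|[rho [rho1 ->]]].
  exists (stretch (m1 / m2) (n1 / n2) p + r); split.
    rewrite -pr (le_trans (ler_normD _ _)) // lerD2r.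
    by rewrite norm_stretch_le ?norm_div_le1.
  by rewrite stretchD stretchM !divfK_le.
have [t [t0 t1 tE]] := split_unit_disc (m1 / m2) rho1.
exists t%:C, (rho - (m1 / m2 * t)%:C); split.
  by rewrite tE ger0_norm ?ler0c // -rmorphD addrC subrK.
case: rho {rho1 tE} => a b; rewrite /stretch /=; simpc.
by rewrite mulrBr mulrA divfK_le // addrC subrK.
Qed.

(** The vectors [u] and [v] may be dependent over the reals, in which case the
    disc degenerates to a segment or a point. *)
Definition elliptic_disc (z0 u v : R[i]) : set R[i] :=
  [set z0 + u * (complex.Re rho)%:C + v * (complex.Im rho)%:C
    | rho in [set rho : R[i] | `|rho| <= 1]].

Lemma stretch_elliptic m n l z :
  elliptic_disc 0 (l * m%:C) (l * (0 +i* n)) z <->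
  (exists rho, `|rho| <= 1 /\ z = l * stretch m n rho).
Proof.
suff E rho : 0 + (l * m%:C) * (complex.Re rho)%:C
               + (l * (0 +i* n)) * (complex.Im rho)%:C = l * stretch m n rho.
  split; first by move=> [rho rho1 <-]; exists rho; rewrite E.
  by move=> [rho [rho1 ->]]; exists rho => //; rewrite E.
by rewrite add0r -!mulrA -mulrDr; congr (_ * _); rewrite /stretch; simpc.
Qed.

Lemma elliptic_disc_affine a b z0 u v :
  [set a + b * z | z in elliptic_disc z0 u v] =
  elliptic_disc (a + b * z0) (b * u) (b * v).
Proof.
rewrite eqEsubset; split=> [_ [_ [rho rho1 <-] <-]|_ [rho rho1 <-]].
  by exists rho => //; rewrite !mulrDr !mulrA !addrA.
exists (z0 + u * (complex.Re rho)%:C + v * (complex.Im rho)%:C); first by exists rho.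
by rewrite !mulrDr !mulrA !addrA.
Qed.

End Ellipses.

(** * The range of a matrix with zero diagonal *)

Section AntidiagEllipse.
Variable R : rcfType.
Implicit Types (b c q z : R[i]).

(** Half the sum and half the difference of [sqrt (1 + q)] and [sqrt (1 - q)]:
    the choice for which [h <= g], which orders the two ellipses below. *)
Lemma half_sum_diff_roots (q : R) : 0 <= q <= 1 ->
  exists g h : R, [/\ 0 <= h, h <= g, g ^+ 2 + h ^+ 2 = 1 & 2 * g * h = q].
Proof.
move=> /andP[q0 q1].
pose a := Num.sqrt (1 + q); pose b := Num.sqrt (1 - q).
have aE : a ^+ 2 = 1 + q by rewrite sqr_sqrtr // addr_ge0.
have bE : b ^+ 2 = 1 - q by rewrite sqr_sqrtr // subr_ge0.
have ba : b <= a by apply: ler_wsqrtr; lra.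
have b0 : 0 <= b by rewrite sqrtr_ge0.
exists ((a + b) / 2), ((a - b) / 2); split; [lra|lra| |].
  by transitivity ((a ^+ 2 + b ^+ 2) / 2); [field|rewrite aE bE; field].
by transitivity ((a ^+ 2 - b ^+ 2) / 2); [field|rewrite aE bE; field].
Qed.

Lemma two_phase_sum_stretch (g h b c : R) p r :
  two_phase_sum g%:C h%:C b%:C c%:C p r =
  stretch (b * h ^+ 2 + c * g ^+ 2) (b * h ^+ 2 - c * g ^+ 2) p +
  stretch (b * g ^+ 2 + c * h ^+ 2) (b * g ^+ 2 - c * h ^+ 2) r.
Proof.
rewrite /two_phase_sum -!rmorphXn; case: p r => [p1 p2] [r1 r2].
rewrite /stretch /Num.conj /=; simpc; congr (_ +i* _); ring.
Qed.

Lemma stretch_sum_elliptic m1 n1 m2 n2 (l : R[i]) :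
  `|m1| <= `|m2| -> `|n1| <= `|n2| ->
  exists u v : R[i],
    [set z | exists p r, `|p| + `|r| = 1 /\
                         z = l * (stretch m1 n1 p + stretch m2 n2 r)] =
    elliptic_disc 0 u v.
Proof.
move=> lem len; exists (l * m2%:C), (l * (0 +i* n2)).
rewrite eqEsubset; split=> z.
  move=> [p [r [pr ->]]]; apply/stretch_elliptic.
  have [rho [rho1 ->]] : exists rho, `|rho| <= 1 /\
      stretch m1 n1 p + stretch m2 n2 r = stretch m2 n2 rho.
    by apply/(stretch_sum_disc _ lem len); exists p, r.
  by exists rho.
move=> /stretch_elliptic [rho [rho1 ->]].
have /(stretch_sum_disc _ lem len) [p [r [pr ->]]] : exists rho', `|rho'| <= 1 /\
    stretch m2 n2 rho = stretch m2 n2 rho' by exists rho.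
by exists p, r.
Qed.

(** Once the phases are removed and [0 <= h <= g], both half-axes of the ellipse
    swept by [r] dominate those of the ellipse swept by [p] if [|c| <= |b|], and
    conversely if [|b| <= |c|]. *)
Lemma antidiag_range_elliptic b c q : `|q| <= 1 ->
  exists u v, antidiag_range b c q = elliptic_disc 0 u v.
Proof.
move=> q1; have [k k1 qE] := unit_phase q.
have [q0 q0E] : exists q0 : R, `|q| = q0%:C.
  by exists (complex.Re `|q|); rewrite RRe_real // normr_real.
have q01 : 0 <= q0 <= 1.
  by move: (normr_ge0 q) q1; rewrite q0E ler0c -[1]/(1%:C) lecR => -> ->.
have [g [h [h0 hg gh ghq]]] := half_sum_diff_roots q01.
suff [u [v E]] : exists u v, antidiag_range b c (2 * g%:C * h%:C) = elliptic_disc 0 u v.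
  exists (k * u), (k * v).
  rewrite qE mulrC q0E -ghq !rmorphM /= rmorph_nat antidiag_range_rot // E.
  have := elliptic_disc_affine 0 k 0 u v; rewrite mulr0 addr0 => <-.
  by congr image; apply/funext => z; rewrite add0r.
have realJ (a : R) : Num.conj a%:C = a%:C by exact: conjc_real.
have ghC : g%:C ^+ 2 + h%:C ^+ 2 = 1 by rewrite -!rmorphXn -rmorphD gh.
have [l ->] := antidiag_range_phase b c (realJ g) (realJ h) ghC.
have [b0 b0E] : exists b0 : R, `|b| = b0%:C.
  by exists (complex.Re `|b|); rewrite RRe_real // normr_real.
have [c0 c0E] : exists c0 : R, `|c| = c0%:C.
  by exists (complex.Re `|c|); rewrite RRe_real // normr_real.
have b0_ge0 : 0 <= b0 by rewrite -ler0c -b0E.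
have c0_ge0 : 0 <= c0 by rewrite -ler0c -c0E.
have h2_ge0 : 0 <= h ^+ 2 by rewrite sqr_ge0.
have hg2 : h ^+ 2 <= g ^+ 2 by rewrite ler_sqr ?nnegrE //; lra.
rewrite b0E c0E.
have [lebc|lecb] := leP b0 c0.
  have [||u [v uvE]] := @stretch_sum_elliptic
      (b0 * g ^+ 2 + c0 * h ^+ 2) (b0 * g ^+ 2 - c0 * h ^+ 2)
      (b0 * h ^+ 2 + c0 * g ^+ 2) (b0 * h ^+ 2 - c0 * g ^+ 2) l.
  - by rewrite !ger0_norm; nra.
  - by rewrite [`|_ * h ^+ 2 - _|]ler0_norm ?ler_norml; nra.
  exists u, v; rewrite -uvE eqEsubset; split=> _ [p [r [pr ->]]];
    exists r, p; rewrite addrC pr; split => //; congr (_ * _);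
    by rewrite two_phase_sum_stretch addrC.
have [||u [v uvE]] := @stretch_sum_elliptic
      (b0 * h ^+ 2 + c0 * g ^+ 2) (b0 * h ^+ 2 - c0 * g ^+ 2)
      (b0 * g ^+ 2 + c0 * h ^+ 2) (b0 * g ^+ 2 - c0 * h ^+ 2) l.
- by rewrite !ger0_norm; nra.
- by rewrite [`|_ * g ^+ 2 - _|]ger0_norm ?ler_norml; nra.
exists u, v; rewrite -uvE eqEsubset; split=> _ [p [r [pr ->]]];
  by exists p, r; rewrite two_phase_sum_stretch.
Qed.

End AntidiagEllipse.

(** * Operators on a Hilbert plane *)

Section Plane.
Context (R : realType) (H : vectType R[i]) (dot : {dot H for Num.conj}).
Context (dimH : \dim {:H} = 2%N).
Implicit Types (x y e f : H) (A S : 'End(H)) (a b c q t : R[i]).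

Let dotC x y : dot x y = Num.conj (dot y x).
Proof. by rewrite hermC expr0 mul1r. Qed.

Definition orthonormal_pair e f : Prop :=
  [/\ dot e e = 1, dot f f = 1 & dot e f = 0].

Lemma normalized x : x != 0 -> exists2 a, a != 0 & dot (a *: x) (a *: x) = 1.
Proof.
move=> x0; have d0 : dot x x != 0 by rewrite dnorm_eq0.
have s0 : sqrtC (dot x x) != 0 by rewrite sqrtC_eq0.
exists (sqrtC (dot x x))^-1; first by rewrite invr_eq0.
rewrite dnormZ normfV exprVn ger0_norm ?sqrtC_ge0 ?dnorm_ge0 //.
by rewrite sqrtCK mulVf.
Qed.

Lemma exists_orthonormal_pair : exists e f, orthonormal_pair e f.
Proof.
have V0 : {:H}%VS != 0%VS by rewrite -dimv_eq0 dimH.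
pose x := vpick {:H}%VS; have x0 : x != 0 by rewrite vpick0.
have := leq_dim_orthov1 dot x {:H}%VS; rewrite dimH /= capfv => dx.
have U0 : orthov dot <[x]>%VS != 0%VS by rewrite -dimv_eq0 -lt0n.
pose y := vpick (orthov dot <[x]>%VS); have y0 : y != 0 by rewrite vpick0.
have yx : dot y x = 0 by apply/eqP; rewrite -(mem_orthov1 dot) memv_pick.
have [a a0 xa] := normalized x0; have [b b0 yb] := normalized y0.
exists (a *: x), (b *: y); split => //.
by rewrite linearZl_LR linearZr_LR /= dotC yx rmorph0 !mulr0.
Qed.

Lemma orthonormal_expand e f x : orthonormal_pair e f ->
  x = dot x e *: e + dot x f *: f.
Proof.
move=> [ee ff ef].
have fe : dot f e = 0 by rewrite dotC ef rmorph0.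
have ef_free : free [:: e; f].
  apply: (@orthonormal_free _ _ dot); apply/orthonormal2P.
  by split.
have : x \in <<[:: e; f]>>%VS.
  have /eqP -> : <<[:: e; f]>>%VS == fullv; last exact: memvf.
  by rewrite eqEdim subvf dimH (eqnP ef_free).
rewrite span_cons span_seq1 => /memv_addP [_ /vlineP [a ->] [_ /vlineP [b ->] ->]].
rewrite !linearDl !linearZl_LR /= ee ff ef fe.
by rewrite !mulr1 !mulr0 addr0 add0r.
Qed.

Lemma orthonormal_dot e f a1 a2 b1 b2 : orthonormal_pair e f ->
  dot (a1 *: e + a2 *: f) (b1 *: e + b2 *: f) =
  a1 * Num.conj b1 + a2 * Num.conj b2.
Proof.
move=> [ee ff ef]; have fe : dot f e = 0 by rewrite dotC ef rmorph0.
rewrite !linearDl !linearDr !linearZl_LR !linearZr_LR /= ee ff ef fe.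
by rewrite !mulr0 !mulr1 addr0 add0r.
Qed.

(** A unit vector that is isotropic for [A - t], with [2 t] the trace of [A], has
    diagonal entry [t]; the orthogonal unit vector has the same entry because
    the trace does not depend on the basis. *)
Lemma equal_diagonal_basis A : exists t b c e f,
  [/\ orthonormal_pair e f, A e = t *: e + c *: f & A f = b *: e + t *: f].
Proof.
have [e [f ef]] := exists_orthonormal_pair.
pose a11 := dot (A e) e; pose a21 := dot (A e) f.
pose a12 := dot (A f) e; pose a22 := dot (A f) f.
have Ae : A e = a11 *: e + a21 *: f by exact: orthonormal_expand.
have Af : A f = a12 *: e + a22 *: f by exact: orthonormal_expand.
have AE a b : A (a *: e + b *: f) =
    (a11 * a + a12 * b) *: e + (a21 * a + a22 * b) *: f.
  rewrite linearD !linearZ /= Ae Af !scalerDr !scalerA !scalerDl addrACA.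
  by rewrite [a * a11]mulrC [a * a21]mulrC [b * a12]mulrC [b * a22]mulrC.
pose t := (a11 + a22) / 2.
have [x1 [x2 [xN x0]]] := traceless_isotropic ((a11 - a22) / 2) a12 a21.
pose e' := x1 *: e + x2 *: f.
pose f' := - Num.conj x2 *: e + Num.conj x1 *: f.
have ef' : orthonormal_pair e' f'.
  split; rewrite orthonormal_dot // ?rmorphN /= ?conjCK //; last by ring.
  by rewrite -xN; ring.
have e't : dot (A e') e' = t.
  rewrite AE orthonormal_dot //.
  transitivity (t * (x1 * Num.conj x1 + x2 * Num.conj x2) +
    ((a11 - a22) / 2 * (x1 * Num.conj x1 - x2 * Num.conj x2)
     + a12 * (x2 * Num.conj x1) + a21 * (x1 * Num.conj x2))).
    by rewrite /t; field.
  by rewrite xN x0 mulr1 addr0.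
have f't : dot (A f') f' = t.
  rewrite AE orthonormal_dot // rmorphN /= !conjCK.
  transitivity (t * (x1 * Num.conj x1 + x2 * Num.conj x2) -
    ((a11 - a22) / 2 * (x1 * Num.conj x1 - x2 * Num.conj x2)
     + a12 * (x2 * Num.conj x1) + a21 * (x1 * Num.conj x2))).
    by rewrite /t; field.
  by rewrite xN x0 mulr1 subr0.
exists t, (dot (A f') e'), (dot (A e') f'), e', f'; split => //.
  by rewrite -e't; exact: orthonormal_expand.
by rewrite -f't; exact: orthonormal_expand.
Qed.

Lemma dot_norm1 x : dot_norm dot x = 1 <-> dot x x = 1.
Proof.
split=> x1; last by rewrite /dot_norm x1 sqrtC1.
by rewrite -[LHS]sqrtCK -/(dot_norm dot x) x1 expr1n.
Qed.

(** In the basis of [equal_diagonal_basis], [A - t] has zero diagonal, and [t]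
    adds [t * dot x y = t * q] to every value. *)
Lemma qrange_elliptic A q : `|q| <= 1 -> exists z0 u v,
  [set dot (A p.1) p.2 | p in qsphere dot q] = elliptic_disc z0 u v.
Proof.
move=> q1; have [t [b [c [e [f [ef Ae Af]]]]]] := equal_diagonal_basis A.
have [u [v E]] := antidiag_range_elliptic b c q1.
exists (t * q + 1 * 0), (1 * u), (1 * v).
rewrite -elliptic_disc_affine -E.
have AE (x1 x2 y1 y2 : R[i]) : x1 * Num.conj y1 + x2 * Num.conj y2 = q ->
    dot (A (x1 *: e + x2 *: f)) (y1 *: e + y2 *: f) =
    t * q + 1 * (b * (x2 * Num.conj y1) + c * (x1 * Num.conj y2)).
  move=> <-.
  have -> : A (x1 *: e + x2 *: f) =
      (x1 * t + x2 * b) *: e + (x1 * c + x2 * t) *: f.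
    rewrite linearD !linearZ /= Ae Af.
    by rewrite !scalerDr !scalerA addrACA -!scalerDl.
  by rewrite orthonormal_dot //; ring.
rewrite eqEsubset; split=> [_ [[x y] [/= xN yN xy] <-]|].
  move: xN yN xy; rewrite !dot_norm1.
  rewrite [x](orthonormal_expand x ef) [y](orthonormal_expand y ef).
  move: (dot x e) (dot x f) (dot y e) (dot y f) => x1 x2 y1 y2.
  rewrite !orthonormal_dot // => xN yN xy; rewrite AE //.
  eexists; last by []. by exists x1, x2, y1, y2.
move=> _ [_ [x1 [x2 [y1 [y2 [[xN yN xy] ->]]]]] <-].
exists (x1 *: e + x2 *: f, y1 *: e + y2 *: f); last exact: AE.
by split; rewrite /= ?dot_norm1 orthonormal_dot.
Qed.

(** As [c != 0], the vector [e] is cyclic: [e] and [A e] span the plane.  Choose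
    [a], [b] so that [S e = a e + b A e]; then [S - a - b A] kills [e], and also
    [A e] because it commutes with [A]. *)
Lemma cyclic_commutant A S e f t c : orthonormal_pair e f ->
  A e = t *: e + c *: f -> c != 0 -> (A \o S)%VF = (S \o A)%VF ->
  exists a b, forall x, S x = a *: x + b *: A x.
Proof.
move=> ef Ae c0 AS.
pose b := dot (S e) f / c; pose a := dot (S e) e - b * t.
exists a, b; pose D := S - a *: \1%VF - b *: A.
have DE x : D x = S x - (a *: x + b *: A x).
  by rewrite /D !(add_lfunE, opp_lfunE, scale_lfunE) id_lfunE opprD addrA.
have De : D e = 0.
  rewrite DE [S e](orthonormal_expand (S e) ef) Ae scalerDr !scalerA addrA -scalerDl.
  by rewrite /a subrK divfK // subrr.
have DA x : D (A x) = A (D x).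
  have ASx : A (S x) = S (A x) by rewrite -!comp_lfunE AS.
  have AE y : A (S x - (a *: x + b *: y)) = A (S x) - (a *: A x + b *: A y).
    by rewrite linearB [X in _ - X]linearD !linearZ.
  by rewrite !DE AE ASx.
have Df : D f = 0.
  have -> : f = c^-1 *: (A e - t *: e).
    by rewrite Ae addrC addKr scalerA mulVf // scale1r.
  by rewrite linearZ linearB linearZ /= DA De linear0 scaler0 subr0 scaler0.
move=> x; apply/eqP; rewrite -subr_eq0 -DE [x](orthonormal_expand x ef).
by rewrite linearD !linearZ /= De Df !scaler0 addr0.
Qed.

(** In the basis of [equal_diagonal_basis], a nonscalar [A] has a nonzero
    off-diagonal entry, so one of the two basis vectors is cyclic. *)
Lemma commutant_nonscalar A S : ~ scalar_operator A ->
  (A \o S)%VF = (S \o A)%VF -> exists a b, forall x, S x = a *: x + b *: A x.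
Proof.
move=> nsA AS; have [t [b [c [e [f [ef Ae Af]]]]]] := equal_diagonal_basis A.
have [c0|c0] := eqVneq c 0; last exact: cyclic_commutant ef Ae c0 AS.
have [b0|b0] := eqVneq b 0.
  case: nsA; exists t; apply/lfunP=> x.
  rewrite scale_lfunE id_lfunE {1}(orthonormal_expand x ef).
  rewrite linearD !linearZ /= Ae Af c0 b0 !scale0r addr0 add0r.
  rewrite {3}(orthonormal_expand x ef) scalerDr !scalerA.
  by rewrite [t * dot x e]mulrC [t * dot x f]mulrC.
apply: (@cyclic_commutant A S f e t b) => //; last by rewrite addrC.
by case: ef => ee ff ef; split => //; rewrite dotC ef rmorph0.
Qed.

End Plane.

(** The set is the image of the unit disc under a real-affine map, and the weight
    of a complex convex combination is real. *)
Lemma elliptic_disc_affine_convex (R : realType) (d : nat) (z0 u v : R[i])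
    (a b : 'I_d -> R[i]) :
  convex_set [set \row_j (a j + b j * z) | z in elliptic_disc z0 u v].
Proof.
move=> _ _ k /set_mem [_ [rho rho1 <-] <-] /set_mem [_ [sg sg1 <-] <-].
apply/mem_set.
have [t kt] : exists t : R, k%:num = t%:C.
  by exists (complex.Re k%:num); rewrite RRe_real // ger0_real // ge0.
have k0 : 0 <= k%:num :> R[i] by exact: ge0.
have k1 : k%:num <= 1 :> R[i] by exact: le1.
have k1' : 0 <= 1 - k%:num :> R[i] by rewrite subr_ge0.
have k1E : 1 - k%:num = (1 - t)%:C :> R[i] by rewrite kt rmorphB.
pose th := k%:num * rho + (1 - k%:num) * sg.
have th1 : `|th| <= 1.
  rewrite (le_trans (ler_normD _ _)) // !normrM (ger0_norm k0) (ger0_norm k1').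
  have kE : k%:num * 1 + (1 - k%:num) * 1 = 1 :> R[i].
    by rewrite !mulr1 addrC subrK.
  by rewrite -[leRHS]kE lerD // ler_wpM2l.
exists (z0 + u * (complex.Re th)%:C + v * (complex.Im th)%:C); first by exists th.
have -> : (complex.Re th)%:C =
    k%:num * (complex.Re rho)%:C + (1 - k%:num) * (complex.Re sg)%:C.
  by rewrite /th k1E kt; case: (rho) (sg) => [? ?] [? ?]; simpc.
have -> : (complex.Im th)%:C =
    k%:num * (complex.Im rho)%:C + (1 - k%:num) * (complex.Im sg)%:C.
  by rewrite /th k1E kt; case: (rho) (sg) => [? ?] [? ?]; simpc.
by apply/rowP=> j; rewrite !mxE /unstable.onem; ring.
Qed.

(* In convex_set the coefficient ranges over {i01 R[i]}, the x : R[i] with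
   0 <= x <= 1; in the order of R[i] this forces x to be real. *)
Theorem theorem6 (R : realType) (H : vectType R[i])
    (dot : {dot H for Num.conj}) (q : R[i]) (d : nat)
    (T : 'I_d -> 'End(H)) :
  `|q| <= 1 ->
  (0 < d)%N ->
  \dim {:H} = 2%N ->
  (exists i : 'I_d, ~ scalar_operator (T i) /\
     forall j : 'I_d, j <> i -> (T i \o T j)%VF = (T j \o T i)%VF) ->
  convex_set (joint_qrange dot q T).
Proof.
move=> q1 _ dimH [i [nsT TT]].
have [z0 [u [v E]]] := qrange_elliptic dot dimH (T i) q1.
have {}TT j : exists ab, forall x, T j x = ab.1 *: x + ab.2 *: T i x.
  have [a [b ab]] : exists a b, forall x, T j x = a *: x + b *: T i x.
    apply: (commutant_nonscalar dot dimH) => //.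
    by have [-> //|/eqP /TT] := eqVneq j i.
  by exists (a, b).
have {TT} [ab abE] := choice TT.
suff -> : joint_qrange dot q T =
  [set \row_j ((ab j).1 * q + (ab j).2 * z) | z in elliptic_disc z0 u v].
  exact: elliptic_disc_affine_convex.
have rowE p : qsphere dot q p -> \row_j dot (T j p.1) p.2 =
    \row_j ((ab j).1 * q + (ab j).2 * dot (T i p.1) p.2).
  move=> [_ _ pq]; apply/rowP=> j; rewrite !mxE abE linearDl !linearZl_LR /=.
  by rewrite pq.
rewrite -E eqEsubset; split=> [_ [p pq <-]|_ [_ [p pq <-] <-]].
  by exists (dot (T i p.1) p.2); [exists p|rewrite rowE].
by exists p => //; exact: rowE.
Qed.
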